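(* There exist absolute (numerical) constants $c,C>0$ such that the following holds. Let $n,K\ge 1$ be integers, let $f_1,\dots,f_n:\mathbb{R}^{d_x}\times\mathbb{R}^{d_y}\to\mathbb{R}$ and $f=\frac1n\sum_{i=1}^n f_i$. Suppose: (a) every $f_i$ is differentiable and $\nabla f_i$ is $L$-Lipschitz, where $L>0$; (b) there are $A,B\ge 0$ with $\frac1n\sum_{i=1}^n\|\nabla_j f_i(z)-\nabla_j f(z)\|^2\le A\|\nabla_j f(z)\|^2+B$ for all $z\in\mathbb{R}^{d_x}\times\mathbb{R}^{d_y}$ and $j\in\{1,2\}$; (c) $\Phi(x):=\max_{y'} f(x;y')$ is well-defined for every $x$, the set $\operatorname{argmax}_{y'}f(x;y')$ is non-empty and closed for every $x$, and $\Phi^*:=\inf_x\Phi(x)>-\infty$; (d) there is $\mu_2>0$ with $\|\nabla_2 f(x;y)\|^2\ge 2\mu_2(\Phi(x)-f(x;y))$ for all $(x;y)$. Let $\kappa_2=L/\mu_2$, $\lambda=4$, and let $r\ge 14\kappa_2^2$. Choose the step sizes $$\beta=\min\left\{\frac{1}{6L\sqrt{n(n+A)}},\ \frac1c\left(\frac{V_\lambda(z_0^1)}{L^2Bn^2K}\right)^{1/3}\right\},\qquad \alpha=\frac{\beta}{r}.$$ Then both simSGDA-RR and altSGDA-RR, started at $z_0^1=(x_0^1;y_0^1)$ and run for $K$ epochs with step sizes $\alpha,\beta$, satisfy $$\frac1K\sum_{k=1}^K\mathbb{E}\|\nabla\Phi(x_0^k)\|^2\le C\left(\frac{rL\,V_\lambda(z_0^1)}{K}\sqrt{1+\frac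 An}+r\left(\frac{L^2B\,V_\lambda(z_0^1)^2}{nK^2}\right)^{1/3}\right).$$
   Context: Notation: $z=(x;y)$ with $x\in\mathbb{R}^{d_x}$, $y\in\mathbb{R}^{d_y}$; $\nabla_1,\nabla_2$ are the gradients with respect to $x$ and $y$; $\|\cdot\|$ is the Euclidean norm. Under (a), (c), (d) the function $\Phi$ is differentiable. The potential function is $V_\lambda(x;y)=\lambda(\Phi(x)-\Phi^* )+(\Phi(x)-f(x;y))$. Algorithm (SGDA with random reshuffling): the initial point $(x_0^1;y_0^1)$ is given. In each epoch $k=1,\dots,K$, a permutation $\sigma_k$ of $\{1,\dots,n\}$ is sampled uniformly at random (independently over epochs). For $i=1,\dots,n$: $x_i^k=x_{i-1}^k-\alpha\nabla_1 f_{\sigma_k(i)}(x_{i-1}^k;y_{i-1}^k)$, and $y_i^k=y_{i-1}^k+\beta\nabla_2 f_{\sigma_k(i)}(x';y_{i-1}^k)$ with $x'=x_{i-1}^k$ for simSGDA-RR and $x'=x_i^k$ for altSGDA-RR. Then $(x_0^{k+1};y_0^{k+1})=(x_n^k;y_n^k)$. $\mathbb{E}$ is over the permutations. Convention: a fraction with zero denominator is treated as $+\infty$.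
   Formalization: The formal theorem adds the hypothesis μ₂ ≤ L (κ₂ ≥ 1); it follows from (a), (c), (d) unless f does not depend on y, and in that case the claim fails as stated when μ₂ is large and r is small. *)

(* Defs.v *)
From mathcomp Require Export all_boot all_order all_algebra.
From mathcomp Require Export all_fingroup.
From mathcomp Require Export all_classical all_reals all_analysis.

Set Implicit Arguments.
Unset Strict Implicit.
Unset Printing Implicit Defensive.

Export Order.TTheory GRing.Theory Num.Theory.
Export numFieldNormedType.Exports.

Local Open Scope classical_set_scope.
Local Open Scope ring_scope.

(* MathComp-Analysis norms matrices with the max norm, hence this definition. *)
Definition enorm (R : realType) (d : nat) (v : 'rV[R]_d) : R :=
  Num.sqrt (\sum_(i < d) v 0 i ^+ 2).

Definition grad (R : realType) (d : nat) (g : 'rV[R]_d -> R) (z : 'rV[R]_d) :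
    'rV[R]_d :=
  \row_i 'D_(delta_mx 0 i) g z.

Section Minimax.
Variables (R : realType) (dx dy : nat).

(* A point z = (x; y) is the concatenation row_mx x y, so that enorm on
   'rV_(dx + dy) is the Euclidean norm of the pair. *)
Implicit Types (f g : 'rV[R]_(dx + dy) -> R) (z : 'rV[R]_(dx + dy)).

Definition grad1 f z : 'rV[R]_dx := lsubmx (grad f z).
Definition grad2 f z : 'rV[R]_dy := rsubmx (grad f z).

Definition argmax2 f (x : 'rV[R]_dx) : set 'rV[R]_dy :=
  [set y | forall y' : 'rV[R]_dy, f (row_mx x y') <= f (row_mx x y)].

(* The real sup is a maximum exactly when argmax2 f x is non-empty. *)
Definition Phi f (x : 'rV[R]_dx) : R :=
  sup [set f (row_mx x y) | y in [set: 'rV[R]_dy]].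

(* Meaningful when range (Phi f) is bounded below. *)
Definition Phi_min f : R := inf (range (Phi f)).

Definition potential (lambda : R) f z : R :=
  lambda * (Phi f (lsubmx z) - Phi_min f) + (Phi f (lsubmx z) - f z).

Inductive variant := simSGDA | altSGDA.

Definition sgda_step (v : variant) (alpha beta : R) z g : 'rV[R]_(dx + dy) :=
  let x := lsubmx z in
  let y := rsubmx z in
  let x1 := x - alpha *: grad1 g z in
  let x' := match v with simSGDA => x | altSGDA => x1 end in
  row_mx x1 (y + beta *: grad2 g (row_mx x' y)).

Section Finite_sum.
Variables (n : nat) (F : 'I_n -> 'rV[R]_(dx + dy) -> R).

Definition favg z : R := n%:R^-1 * \sum_(i < n) F i z.

(* enum 'I_n is increasing: the components are visited in the order
   sigma 0, sigma 1, ..., sigma (n - 1). *)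
Definition sgda_epoch (v : variant) (alpha beta : R) z (sigma : 'S_n) :
    'rV[R]_(dx + dy) :=
  foldl (sgda_step v alpha beta) z [seq F (sigma i) | i <- enum 'I_n].

(* With sigmas = [:: sigma_1; ...; sigma_k], the point (x_0^{k+1}; y_0^{k+1}). *)
Definition sgda_epochs (v : variant) (alpha beta : R) z (sigmas : seq 'S_n) :
    'rV[R]_(dx + dy) :=
  foldl (sgda_epoch v alpha beta) z sigmas.

End Finite_sum.
End Minimax.

(* K independent uniform permutations of 'I_n are jointly uniform on the
   K-tuples of permutations. *)
Definition Eperm (R : realType) (n K : nat) (X : K.-tuple 'S_n -> R) : R :=
  #|{: K.-tuple 'S_n}|%:R^-1 * \sum_(s : K.-tuple 'S_n) X s.

(* When B = 0 the fraction V / (L^2 B n^2 K) counts as +oo (even if V = 0), so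
   only the first term of the minimum remains. *)
Definition beta_step (R : realType) (c L A B V : R) (n K : nat) : R :=
  let b := (6 * L * Num.sqrt (n%:R * (n%:R + A)))^-1 in
  let den := L ^+ 2 * B * n%:R ^+ 2 * K%:R in
  if den == 0 then b else Num.min b (c^-1 * (V / den) `^ 3^-1).

(* Main.v *)
Require Import Defs.
From mathcomp Require Import ring lra.

Set Implicit Arguments.
Unset Strict Implicit.
Unset Printing Implicit Defensive.

Local Open Scope classical_set_scope.
Local Open Scope ring_scope.

(** Over one epoch every component is visited exactly once, so an epoch of SGDA
    is one step of full gradient descent-ascent with step sizes [n alpha] and
    [n beta], up to an error caused by evaluating the components at moving
    points ([epoch_increment]). By smoothness the error is controlled by how far
    the iterates drift from the start of the epoch; with small steps this drift
    is at most twice what it would be with all gradients taken at the starting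
    point, and the latter is a sum of squared partial sums of a random shuffle.
    Draws without replacement are negatively correlated, so such a partial sum
    of [i] terms has second moment at most [i^2 |g|^2 + i sigma^2]
    ([sampling_second_moment]). Hence, up to constants, the squared
    errors are a fraction [L^2 beta^2 n (n + A) <= 1/36] of the squared full
    gradient, plus [L^2 beta^2 n B].

    The PL condition makes the primal function smooth. At [(x + h, y)] with [y]
    a maximizer for [x], PL bounds [Phi - f] by a multiple of [|h|^2], which
    gives at once the differentiability of [Phi], the formula
    [grad Phi x = grad1 f (x, y)] and a quadratic upper model with constant
    [L (1 + kappa)] ([Phi_quad]). Since [Phi - f (., y)] is nonnegative and
    smooth, its gradient is bounded by its value, hence by the dual gradient:
    [|grad Phi - grad1 f|^2 <= 3 kappa^2 |grad2 f|^2] ([grad_Phi_gap]).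

    The potential [3/2 (Phi - Phi_min) + (Phi - f)] then decreases in
    expectation by [n alpha |grad Phi|^2] per epoch, up to noise
    ([epoch_descent]). The ascent step gains [n beta |grad2 f|^2 / 2], and
    [beta / alpha = r >= 14 kappa^2] makes this larger than all the terms in
    which [grad1 f] replaces [grad Phi] and than the errors. Summing over the
    epochs ([telescope]) bounds the average of [|grad Phi|^2] by
    [r V0 / (K n beta) + 7 r L^2 n beta^2 B]; the second candidate in the
    definition of [beta] is the value that balances these two terms
    ([noise_balance]). *)

(** * Euclidean geometry of row vectors *)

Definition dot (R : realType) (d : nat) (u v : 'rV[R]_d) : R :=
  \sum_(i < d) u 0 i * v 0 i.

Notation sqn u := (dot u u).

Section Euclidean.
Variables (R : realType) (d : nat).
Implicit Types (u v w : 'rV[R]_d) (a b : R).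

Lemma enormE u : enorm u ^+ 2 = sqn u.
Proof.
rewrite /enorm sqr_sqrtr; last by apply: sumr_ge0 => i _; exact: sqr_ge0.
by apply: eq_bigr => i _; rewrite expr2.
Qed.

Lemma sqn_ge0 u : 0 <= sqn u.
Proof. by rewrite -enormE sqr_ge0. Qed.

Lemma dotC u v : dot u v = dot v u.
Proof. by apply: eq_bigr => i _; rewrite mulrC. Qed.

Lemma dotDl u v w : dot (u + v) w = dot u w + dot v w.
Proof.
by rewrite /dot -big_split; apply: eq_bigr => i _; rewrite mxE mulrDl.
Qed.

Lemma dotDr u v w : dot w (u + v) = dot w u + dot w v.
Proof. by rewrite dotC dotDl !(dotC w). Qed.

Lemma dotZl a u v : dot (a *: u) v = a * dot u v.
Proof. by rewrite /dot mulr_sumr; apply: eq_bigr => i _; rewrite mxE mulrA. Qed.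

Lemma dotZr a u v : dot u (a *: v) = a * dot u v.
Proof. by rewrite dotC dotZl dotC. Qed.

Lemma dotNl u v : dot (- u) v = - dot u v.
Proof. by rewrite -scaleN1r dotZl mulN1r. Qed.

Lemma dotNr u v : dot u (- v) = - dot u v.
Proof. by rewrite dotC dotNl dotC. Qed.

Lemma dot0l u : dot 0 u = 0.
Proof. by rewrite -(scale0r u) dotZl mul0r. Qed.

Lemma dot_suml (I : finType) (P : pred I) (F : I -> 'rV[R]_d) v :
  dot (\sum_(i | P i) F i) v = \sum_(i | P i) dot (F i) v.
Proof.
by apply: (big_morph (fun u => dot u v)) => [u w|]; rewrite ?dotDl ?dot0l.
Qed.

Lemma dot_sumr (I : finType) (P : pred I) (F : I -> 'rV[R]_d) v :
  dot v (\sum_(i | P i) F i) = \sum_(i | P i) dot v (F i).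
Proof. by rewrite dotC dot_suml; apply: eq_bigr => i _; rewrite dotC. Qed.

Lemma sqnD u v : sqn (u + v) = sqn u + 2 * dot u v + sqn v.
Proof. by rewrite dotDl !dotDr (dotC v u); ring. Qed.

Lemma sqnB u v : sqn (u - v) = sqn u - 2 * dot u v + sqn v.
Proof. by rewrite sqnD dotNr dotNl dotNr; ring. Qed.

Lemma sqnZ a u : sqn (a *: u) = a ^+ 2 * sqn u.
Proof. by rewrite dotZl dotZr mulrA expr2. Qed.

Lemma sqnN u : sqn (- u) = sqn u.
Proof. by rewrite dotNl dotNr opprK. Qed.

(** Young's inequality with a free weight, the only form in which
    Cauchy-Schwarz is needed below. *)
Lemma young a u v : 0 < a -> 2 * dot u v <= a * sqn u + a^-1 * sqn v.
Proof.
move=> a0; have := sqn_ge0 (a *: u - v).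
rewrite sqnB sqnZ dotZl => h.
rewrite -(ler_pM2l a0) mulrDr (mulrA a a^-1) divff ?gt_eqF// mul1r.
by lra.
Qed.

Lemma sqnD_le a u v : 0 < a ->
  sqn (u + v) <= (1 + a) * sqn u + (1 + a^-1) * sqn v.
Proof. by move=> a0; rewrite sqnD; have := young u v a0; lra. Qed.

Lemma sqn_sum_le (I : finType) (P : pred I) (F : I -> 'rV[R]_d) :
  sqn (\sum_(i | P i) F i) <= #|P|%:R * \sum_(i | P i) sqn (F i).
Proof.
rewrite dot_suml; under eq_bigr do rewrite dot_sumr.
apply: (@le_trans _ _ (\sum_(i | P i) \sum_(j | P j)
  (2^-1 * sqn (F i) + 2^-1 * sqn (F j)))).
  apply: ler_sum => i _; apply: ler_sum => j _.
  by have := young (F i) (F j) (ltr01 : 0 < 1 :> R); rewrite invr1; lra.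
set S := \sum_(i | P i) sqn (F i); set N : R := #|P|%:R.
have E i : \sum_(j | P j) (2^-1 * sqn (F i) + 2^-1 * sqn (F j)) =
    N / 2 * sqn (F i) + 2^-1 * S.
  by rewrite big_split /= sumr_const -mulr_sumr -[X in X + _]mulr_natl mulrA.
under eq_bigr do rewrite E.
rewrite big_split /= sumr_const -mulr_sumr -[X in _ + X <= _]mulr_natl.
by rewrite -/N -/S; lra.
Qed.

End Euclidean.

Lemma sqn_row_mx (R : realType) (dx dy : nat) (x : 'rV[R]_dx) (y : 'rV[R]_dy) :
  sqn (row_mx x y) = sqn x + sqn y.
Proof.
rewrite /dot big_split_ord /=; congr (_ + _); apply: eq_bigr => i _.
  by rewrite row_mxEl.
by rewrite row_mxEr.
Qed.

Lemma dot_row_mx (R : realType) (dx dy : nat) (x x' : 'rV[R]_dx)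
    (y y' : 'rV[R]_dy) :
  dot (row_mx x y) (row_mx x' y') = dot x x' + dot y y'.
Proof.
rewrite /dot big_split_ord /=; congr (_ + _); apply: eq_bigr => i _.
  by rewrite !row_mxEl.
by rewrite !row_mxEr.
Qed.

Lemma sqn_split (R : realType) (dx dy : nat) (z : 'rV[R]_(dx + dy)) :
  sqn z = sqn (lsubmx z) + sqn (rsubmx z).
Proof. by rewrite -{1 2}(hsubmxK z) sqn_row_mx. Qed.

Lemma sqn_splitB (R : realType) (dx dy : nat) (z w : 'rV[R]_(dx + dy)) :
  sqn (z - w) = sqn (lsubmx z - lsubmx w) + sqn (rsubmx z - rsubmx w).
Proof. by rewrite sqn_split !linearB. Qed.

(** * Gradients and quadratic models *)

Section Quadratic_bounds.
Variables (R : realType) (d : nat).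
Implicit Types (g : 'rV[R]_d -> R) (z v : 'rV[R]_d).

Lemma derive_dot g z v : differentiable g z -> 'D_v g z = dot (grad g z) v.
Proof.
move=> dg; rewrite deriveE// {1}(row_sum_delta v) linear_sum.
by apply: eq_bigr => i _; rewrite linearZ /= mxE deriveE// mulrC.
Qed.

(** The mean value theorem applied along [z + t v] to the gap between [g] and
    its quadratic model: the derivative of the gap is nonpositive for [t > 0]
    because the gradient moves by at most [L t |v|]. *)
Lemma quad_upper g (L : R) : 0 < L -> (forall z, differentiable g z) ->
  (forall z w, sqn (grad g z - grad g w) <= L ^+ 2 * sqn (z - w)) ->
  forall z v, g (z + v) <= g z + dot (grad g z) v + L / 2 * sqn v.
Proof.
move=> L0 dg Lg z v.
pose p (t : R) := g (z + t *: v).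
pose psi (t : R) := p t - t * dot (grad g z) v - L / 2 * sqn v * t ^+ 2.
pose dpsi (t : R) := dot (grad g (z + t *: v)) v - dot (grad g z) v
   - L * sqn v * t.
have eqq t : (fun h : R => h^-1 *: ((p \o shift t) (h *: 1) - p t)) =
    (fun h => h^-1 *: ((g \o shift (z + t *: v)) (h *: v) - g (z + t *: v))).
  apply/funext => h /=; rewrite /p; congr (_ *: (g _ - _)).
  by rewrite scalerDl addrCA; congr (_ + (_ + _)); rewrite /GRing.scale/= mulr1.
have dp (t : R) : is_derive t (1 : R) p (dot (grad g (z + t *: v)) v).
  apply: DeriveDef; last by rewrite -derive_dot// /derive eqq.
  by rewrite /derivable eqq; apply: diff_derivable.
have dpsiE (t : R) : is_derive t (1 : R) psi (dpsi t).
  have -> : psi = p - (dot (grad g z) v \*: (id : R -> R))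
                    - (L / 2 * sqn v \*: ((id : R -> R) ^+ 2)).
    by apply/funext => s; rewrite /psi !fctE /=; rewrite /GRing.scale /= (mulrC s).
  apply: is_derive_eq.
  rewrite /dpsi /GRing.scale /= expr1; lra.
have dpsi_le0 t : 0 < t -> dpsi t <= 0.
  move=> t0; rewrite /dpsi -dotNl -dotDl.
  have Lt : 0 < (L * t)^-1 by rewrite invr_gt0 mulr_gt0.
  (* this weight balances the two halves of Young at L t |v|^2 / 2 each *)
  have := young (grad g (z + t *: v) - grad g z) v Lt.
  have := Lg (z + t *: v) z; rewrite addrAC subrr add0r sqnZ => h1 h2.
  have : (L * t)^-1 * sqn (grad g (z + t *: v) - grad g z) <= L * t * sqn v.
    rewrite ler_pdivrMl ?mulr_gt0//; apply: (le_trans h1).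
    by rewrite le_eqVlt; apply/orP; left; apply/eqP; ring.
  rewrite invrK in h2; lra.
have [c + ] : exists2 c, c \in `]0, 1[%R & psi 1 - psi 0 = dpsi c * (1 - 0).
  apply: MVT => //.
  apply: continuous_subspaceT => t.
  by apply: differentiable_continuous; apply/derivable1_diffP; case: (dpsiE t).
rewrite in_itv /= => /andP[c0 _]; rewrite subr0 mulr1 => h.
have := dpsi_le0 c c0; rewrite -h /psi /p scale1r scale0r addr0 expr1n expr0n /=.
by lra.
Qed.

Lemma gradN g z : differentiable g z -> grad (- g) z = - grad g z.
Proof.
move=> dg; apply/rowP => i; rewrite !mxE deriveN//; exact: diff_derivable.
Qed.

Lemma quad_lower g (L : R) : 0 < L -> (forall z, differentiable g z) ->
  (forall z w, sqn (grad g z - grad g w) <= L ^+ 2 * sqn (z - w)) ->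
  forall z v, g z + dot (grad g z) v - L / 2 * sqn v <= g (z + v).
Proof.
move=> L0 dg Lg z v.
have dN w : differentiable (- g) w by exact: differentiableN.
have := quad_upper L0 dN _ z v; rewrite gradN// dotNl !fctE => h.
suff : - g (z + v) <= - g z - dot (grad g z) v + L / 2 * sqn v by lra.
by apply: h => a b; rewrite !gradN// -opprD sqnN.
Qed.

(** A function bounded below by [m] whose increments have a quadratic upper
    model with slope [a] cannot be steep: evaluate the model at its minimizer
    [- a / M]. This turns smoothness into bounds on gradients throughout. *)
Lemma quad_min (h m M : R) (a : 'rV[R]_d) : 0 < M ->
  (forall v : 'rV[R]_d, m <= h + dot a v + M / 2 * sqn v) ->
  sqn a <= 2 * M * (h - m).
Proof.
move=> M0 /(_ (- M^-1 *: a)); rewrite dotZr sqnZ sqrrN.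
have -> : M / 2 * (M^-1 ^+ 2 * sqn a) = M^-1 / 2 * sqn a by field; rewrite gt_eqF.
move=> H; have : M^-1 * sqn a <= 2 * (h - m) by lra.
by rewrite ler_pdivrMl//; lra.
Qed.

(** A quadratic remainder forces directional derivatives to exist along the
    basis vectors, so the gradient can be read off a first-order expansion. *)
Lemma grad_unique (g : 'rV[R]_d -> R) (x a : 'rV[R]_d) (M : R) :
  (forall v, `|g (x + v) - g x - dot a v| <= M * sqn v) -> grad g x = a.
Proof.
move=> gM; apply/rowP => i; rewrite mxE; set v := delta_mx 0 i.
have dotv : dot a v = a 0 i.
  rewrite /dot (bigD1 i)//= big1 => [|j ji]; rewrite mxE !eqxx/= ?mulr1 ?addr0//.
  by rewrite (negbTE ji) mulr0.
rewrite -dotv /derive; apply: cvg_lim => //.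
apply/cvgrPdist_le => e e0.
have M0 : 0 <= M * sqn v by apply: le_trans (gM v).
have r0 : 0 < e / (M * sqn v + 1) by rewrite divr_gt0// ltr_wpDl.
near=> h.
have h0 : h != 0 by near: h; exact: nbhs_dnbhs_neq.
have he : `|h| <= e / (M * sqn v + 1) by near: h; exact: dnbhs0_le.
rewrite /= distrC -(ler_pM2l (_ : 0 < `|h|)) ?normr_gt0// -normrM.
rewrite mulrBr /GRing.scale /= mulrA divff// mul1r addrC (addrC _ x).
have := gM (h *: v); rewrite dotZr sqnZ [- (h * _) + _]addrC => /le_trans; apply.
rewrite -real_normK ?num_real//; set t := `|h| in he *.
have -> : M * (t ^+ 2 * sqn v) = t * (t * (M * sqn v)) by ring.
rewrite ler_wpM2l ?normr_ge0//.
move: he; rewrite ler_pdivlMr ?ltr_wpDl//; have := normr_ge0 h; rewrite -/t; lra.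
Unshelve. all: by end_near. Qed.

End Quadratic_bounds.

Section Finite_sum_gradient.
Variables (R : realType) (n dx dy : nat) (F : 'I_n -> 'rV[R]_(dx + dy) -> R).
Variable L : R.
Hypothesis n0 : (0 < n)%N.
Hypothesis dF : forall i z, differentiable (F i) z.
Hypothesis LF : forall i z w,
  sqn (grad (F i) z - grad (F i) w) <= L ^+ 2 * sqn (z - w).

Let favgE : favg F = n%:R^-1 *: (\sum_i F i).
Proof. by apply/funext => z; rewrite /favg fctE fct_sumE. Qed.

Lemma differentiable_favg z : differentiable (favg F) z.
Proof. by rewrite favgE; apply/differentiableZ/differentiable_sum. Qed.

Lemma grad_favg z : grad (favg F) z = n%:R^-1 *: \sum_i grad (F i) z.
Proof.
apply/rowP => k; rewrite !mxE summxE favgE.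
have dk i : derivable (F i) z (delta_mx 0 k) by exact: diff_derivable.
rewrite deriveZ; last exact: derivable_sum.
by rewrite derive_sum//; congr (_ * _); apply: eq_bigr => i _; rewrite mxE.
Qed.

Lemma lipschitz_grad_favg z w :
  sqn (grad (favg F) z - grad (favg F) w) <= L ^+ 2 * sqn (z - w).
Proof.
rewrite !grad_favg -scalerBr -sumrB sqnZ.
have n_gt0 : 0 < n%:R :> R by rewrite ltr0n.
rewrite -ler_pdivlMl ?exprn_gt0 ?invr_gt0//.
apply: (le_trans (sqn_sum_le _ _)); rewrite card_ord.
apply: (@le_trans _ _ (n%:R * \sum_(i < n) (L ^+ 2 * sqn (z - w)))).
  by rewrite ler_wpM2l//; exact: ler_sum.
rewrite sumr_const card_ord -[_ *+ n]mulr_natl.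
by rewrite le_eqVlt; apply/orP; left; apply/eqP; field; rewrite gt_eqF.
Qed.

End Finite_sum_gradient.

(** * The primal function *)

Section Primal_function.
Variables (R : realType) (dx dy : nat) (f : 'rV[R]_(dx + dy) -> R) (L mu : R).
Hypotheses (L0 : 0 < L) (mu0 : 0 < mu).
Hypothesis df : forall z, differentiable f z.
Hypothesis Lf : forall z w, sqn (grad f z - grad f w) <= L ^+ 2 * sqn (z - w).
Hypothesis amax : forall x, argmax2 f x !=set0.
Hypothesis PL : forall z, 2 * mu * (Phi f (lsubmx z) - f z) <= sqn (grad2 f z).

Lemma Phi_argmax x y : argmax2 f x y -> Phi f x = f (row_mx x y).
Proof.
move=> xy; apply/eqP; rewrite eq_le; apply/andP; split.
  apply: ge_sup => [|_ [y' _ <-]]; last exact: xy.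
  by exists (f (row_mx x y)), y.
apply: ub_le_sup; last by exists y.
by exists (f (row_mx x y)) => _ [y' _ <-]; exact: xy.
Qed.

Lemma le_Phi x y : f (row_mx x y) <= Phi f x.
Proof. by have [y' xy'] := amax x; rewrite (Phi_argmax xy'). Qed.

Lemma dot_grad z (h : 'rV[R]_dx) (k : 'rV[R]_dy) :
  dot (grad f z) (row_mx h k) = dot (grad1 f z) h + dot (grad2 f z) k.
Proof. by rewrite -[grad f z]hsubmxK dot_row_mx. Qed.

Lemma dot_grad1 z (h : 'rV[R]_dx) :
  dot (grad f z) (row_mx h 0) = dot (grad1 f z) h.
Proof. by rewrite dot_grad (dotC _ 0) dot0l addr0. Qed.

Lemma dot_grad2 z (h : 'rV[R]_dy) :
  dot (grad f z) (row_mx 0 h) = dot (grad2 f z) h.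
Proof. by rewrite dot_grad (dotC _ 0) dot0l add0r. Qed.

(** [quad_min] in the [y] direction, where the gain over the maximum is 0. *)
Lemma grad2_argmax x y : argmax2 f x y -> sqn (grad2 f (row_mx x y)) <= 0.
Proof.
move=> xy; set z := row_mx x y.
rewrite -sqnN -(mulr0 (2 * L)) -(subrr (0 : R)).
apply: quad_min => // h; rewrite add0r dotNl.
have := quad_lower L0 df Lf z (row_mx 0 h).
rewrite dot_grad2 sqn_row_mx dot0l add0r add_row_mx addr0.
by have := xy (y + h); rewrite -/z; lra.
Qed.

Let LPhi : R := L + L ^+ 2 / mu.

(** Fix [y] to be a maximizer at [x] and move only [x]. The lower bound is
    [Phi >= f (., y)] with the smoothness of [f]. For the upper bound, the PL
    inequality at [(x + h, y)] controls [Phi - f] by the squared norm of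
    [grad2 f], which vanished at [(x, y)] and so is now at most [L^2 |h|^2].
    Thus no maximizer at [x + h] has to be compared with [y]. *)
Lemma Phi_quad x y h : argmax2 f x y ->
  Phi f x + dot (grad1 f (row_mx x y)) h - L / 2 * sqn h <= Phi f (x + h)
    <= Phi f x + dot (grad1 f (row_mx x y)) h + LPhi / 2 * sqn h.
Proof.
move=> xy; rewrite (Phi_argmax xy); set z := row_mx x y; set a := grad1 f z.
have zh : z + row_mx h 0 = row_mx (x + h) y by rewrite add_row_mx addr0.
have zsq : sqn (row_mx h 0 : 'rV[R]_(dx + dy)) = sqn h.
  by rewrite sqn_row_mx dot0l addr0.
apply/andP; split.
  have := quad_lower L0 df Lf z (row_mx h 0); rewrite zh dot_grad1 zsq => /le_trans.
  by apply; exact: le_Phi.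
have := quad_upper L0 df Lf z (row_mx h 0); rewrite zh dot_grad1 zsq -/a => ub.
have := PL (row_mx (x + h) y); rewrite row_mxKl => pl.
have := Lf (row_mx (x + h) y) z.
rewrite -zh addrAC subrr add0r zsq zh sqn_split => lip.
have g20 : grad2 f z = 0.
  apply/rowP => i; have := grad2_argmax xy; rewrite -/z => h0.
  have /eqP : sqn (grad2 f z) = 0 by apply/eqP; rewrite eq_le h0 sqn_ge0.
  rewrite psumr_eq0 => [|j _]; last by rewrite -expr2 sqr_ge0.
  move=> /allP /(_ i (mem_index_enum _)); rewrite /= mulf_eq0 orbb => /eqP ->.
  by rewrite mxE.
have : 2 * mu * (Phi f (x + h) - f (row_mx (x + h) y)) <= L ^+ 2 * sqn h.
  apply: (le_trans pl); apply: le_trans lip.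
  rewrite [X in _ <= _ + X](_ : _ = sqn (grad2 f (row_mx (x + h) y))).
    by rewrite lerDr sqn_ge0.
  by rewrite linearB /= -/(grad2 f z) g20 subr0.
rewrite -mulrA mulrCA -ler_pdivlMl// => pl2.
have : LPhi / 2 * sqn h = L / 2 * sqn h + mu^-1 * (L ^+ 2 * sqn h) / 2.
  by rewrite /LPhi; field; rewrite gt_eqF.
lra.
Qed.

Lemma grad_Phi x y : argmax2 f x y -> grad (Phi f) x = grad1 f (row_mx x y).
Proof.
move=> xy; apply: (@grad_unique _ _ _ _ _ (LPhi / 2)) => h.
have /andP[lo up] := Phi_quad h xy; rewrite ler_norml; apply/andP; split; last lra.
suff : L / 2 * sqn h <= LPhi / 2 * sqn h by lra.
rewrite ler_wpM2r ?sqn_ge0// ler_wpM2r// lerDl.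
by rewrite divr_ge0 ?sqr_ge0// ltW.
Qed.

Lemma Phi_upper x h :
  Phi f (x + h) <= Phi f x + dot (grad (Phi f) x) h + LPhi / 2 * sqn h.
Proof.
have [y xy] := amax x; rewrite (grad_Phi xy).
by have /andP[] := Phi_quad h xy.
Qed.

(** For fixed [y], the function [Phi - f (., y)] is nonnegative and has a
    quadratic upper model with constant [LPhi + L], so [quad_min] bounds its
    gradient by its value, and the value is bounded by PL. Going through the
    distance to the set of maximizers would save the factor 3 at the price of a
    quadratic growth lemma. *)
Lemma grad_Phi_gap z : mu <= L ->
  sqn (grad (Phi f) (lsubmx z) - grad1 f z) <= 3 * (L / mu) ^+ 2 * sqn (grad2 f z).
Proof.
move=> muL; set x := lsubmx z; set y := rsubmx z.
have zE : z = row_mx x y by rewrite hsubmxK.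
have M0 : 0 < LPhi + L.
  by rewrite addr_gt0// ltr_wpDr// divr_ge0 ?sqr_ge0// ltW.
have := @quad_min _ _ (Phi f x - f z) 0 _ (grad (Phi f) x - grad1 f z) M0.
rewrite subr0 => /(_ _)/le_trans; apply.
  move=> v; have := Phi_upper x v.
  have := quad_lower L0 df Lf z (row_mx v 0).
  rewrite dot_grad1 sqn_row_mx dot0l addr0 {3}zE add_row_mx addr0.
  have := le_Phi (x + v) y; rewrite dotDl dotNl; lra.
have pl := PL z; rewrite -/x in pl.
have k1 : 1 <= L / mu by rewrite ler_pdivlMr// mul1r.
have -> : 2 * (LPhi + L) * (Phi f x - f z) =
    (L / mu * (2 + L / mu)) * (2 * mu * (Phi f x - f z)).
  by rewrite /LPhi; field; rewrite gt_eqF.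
have k0 : 0 <= L / mu by lra.
apply: (@le_trans _ _ (L / mu * (2 + L / mu) * sqn (grad2 f z))).
  by rewrite ler_wpM2l// mulr_ge0//; lra.
rewrite ler_wpM2r ?sqn_ge0//; nra.
Qed.

Lemma sqn_grad_Phi (m : R) x : (forall x', m <= Phi f x') ->
  sqn (grad (Phi f) x) <= 2 * LPhi * (Phi f x - m).
Proof.
move=> hm; apply: quad_min => [|v].
  by rewrite ltr_wpDr// divr_ge0 ?sqr_ge0// ltW.
exact: le_trans (hm (x + v)) (Phi_upper x v).
Qed.

End Primal_function.

(** * Sampling without replacement *)

Definition mean (R : realType) (T : finType) (X : T -> R) : R :=
  #|T|%:R^-1 * \sum_t X t.

Section Mean.
Variables (R : realType) (T : finType).
Implicit Types X Y : T -> R.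

Lemma meanD X Y : mean (fun t => X t + Y t) = mean X + mean Y.
Proof. by rewrite /mean big_split mulrDr. Qed.

Lemma meanZ (a : R) X : mean (fun t => a * X t) = a * mean X.
Proof. by rewrite /mean -mulr_sumr mulrCA. Qed.

Lemma mean_cst (t0 : T) (a : R) : mean (fun _ : T => a) = a.
Proof.
rewrite /mean sumr_const -[a *+ _]mulr_natl mulrA mulVf ?mul1r// pnatr_eq0 -lt0n.
by apply/card_gt0P; exists t0.
Qed.

Lemma mean_le X Y : (forall t, X t <= Y t) -> mean X <= mean Y.
Proof.
by move=> h; rewrite /mean ler_wpM2l ?invr_ge0 ?ler0n//; exact: ler_sum.
Qed.

Lemma mean_sum (I : finType) (P : pred I) (X : I -> T -> R) :
  mean (fun t => \sum_(i | P i) X i t) = \sum_(i | P i) mean (X i).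
Proof. by rewrite /mean exchange_big /= mulr_sumr. Qed.

Lemma eq_mean X Y : X =1 Y -> mean X = mean Y.
Proof. by move=> h; rewrite /mean; congr (_ * _); apply: eq_bigr. Qed.

End Mean.

Section Shuffling.
Variables (R : realType) (n : nat).
Implicit Types (s : 'S_n) (j k : 'I_n).

Lemma mean_permM (X : 'S_n -> R) s :
  mean X = mean (fun t : 'S_n => X (s * t)%g).
Proof. by rewrite /mean (reindex_inj (mulgI s)). Qed.

Lemma mean_perm_app (phi : 'I_n -> R) j :
  mean (fun s : 'S_n => phi (s j)) = n%:R^-1 * \sum_i phi i.
Proof.
have E k : mean (fun s : 'S_n => phi (s k)) = mean (fun s : 'S_n => phi (s j)).
  by rewrite (mean_permM _ (tperm k j)); apply: eq_mean => s; rewrite permM tpermL.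
have n0 : n%:R != 0 :> R by rewrite pnatr_eq0 -lt0n (leq_ltn_trans _ (ltn_ord j)).
apply: (mulfI n0); rewrite [RHS]mulrA divff// mul1r.
transitivity (\sum_k mean (fun s : 'S_n => phi (s k))).
  by rewrite mulr_natl (eq_bigr _ (fun k _ => E k)) sumr_const card_ord.
rewrite -mean_sum -(mean_cst (1%g : 'S_n) (\sum_i phi i)); apply: eq_mean => s.
by rewrite [RHS](reindex_inj (@perm_inj _ s)).
Qed.

Variables (d : nat) (a : 'I_n -> 'rV[R]_d).
Let g := n%:R^-1 *: \sum_i a i.
Let var := n%:R^-1 * \sum_i sqn (a i - g).
Let pair j k := mean (fun s : 'S_n => dot (a (s j)) (a (s k))).

Let second_moment : (0 < n)%N -> n%:R^-1 * \sum_i sqn (a i) = sqn g + var.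
Proof.
move=> n0; have nn0 : n%:R != 0 :> R by rewrite pnatr_eq0 -lt0n.
rewrite /var; under [in RHS]eq_bigr do rewrite sqnB.
rewrite big_split /= sumr_const card_ord -(mulr_natl (sqn g)).
rewrite sumrB -mulr_sumr -dot_suml.
have -> : \sum_i a i = n%:R *: g by rewrite scalerA divff// scale1r.
by rewrite (dotZl n%:R); field.
Qed.

Let var_ge0 : 0 <= var.
Proof. by rewrite mulr_ge0 ?invr_ge0//; apply: sumr_ge0 => i _; exact: sqn_ge0. Qed.

Let pair_diag j : pair j j = sqn g + var.
Proof.
rewrite /pair (mean_perm_app (fun i => sqn (a i))) second_moment//.
exact: leq_ltn_trans (ltn_ord j).
Qed.

(** The expectations [pair j k] with [k != j] are all equal, and their sum with
    [pair j j] is the mean of [dot (a (s j)) (n g)], that is [n sqn g]. As the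
    diagonal term is at least [sqn g], the off-diagonal ones are at most [sqn g]: draws without
    replacement are negatively correlated. *)
Let pair_off j k : k != j -> pair j k <= sqn g.
Proof.
move=> kj.
have n0 : (0 < n)%N by exact: leq_ltn_trans (ltn_ord j).
have nn0 : n%:R != 0 :> R by rewrite pnatr_eq0 -lt0n.
have E k' : k' != j -> pair j k' = pair j k.
  move=> k'j; rewrite /pair (mean_permM _ (tperm k k')); apply: eq_mean => s.
  by rewrite !permM tpermR tpermD.
have S : \sum_k' pair j k' = n%:R * sqn g.
  rewrite -mean_sum.
  transitivity (mean (fun s : 'S_n => dot (a (s j)) (n%:R *: g))).
    apply: eq_mean => s; rewrite -dot_sumr; congr dot.
    by rewrite scalerA divff// scale1r [RHS](reindex_inj (@perm_inj _ s)).
  rewrite (mean_perm_app (fun i => dot (a i) (n%:R *: g))) -dot_suml.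
  have -> : \sum_i a i = n%:R *: g by rewrite scalerA divff// scale1r.
  by rewrite (dotZl n%:R) (dotZr n%:R); field.
move: S; rewrite (bigD1 j)//= (eq_bigr _ E) pair_diag sumr_const cardC1 card_ord.
have n1 : (0 < n.-1)%N.
  rewrite -subn1 subn_gt0 ltnNge; apply/negP => n1.
  have [+ +] := (leq_trans (ltn_ord j) n1, leq_trans (ltn_ord k) n1).
  rewrite !ltnS !leqn0 => /eqP j0 /eqP k0; case/eqP: kj; apply/val_inj.
  by rewrite /= j0 k0.
have -> : n%:R = n.-1%:R + 1 :> R by rewrite natr1 prednK.
rewrite -mulr_natl => S; rewrite -(ler_pM2l (_ : 0 < n.-1%:R)) ?ltr0n//.
by have := var_ge0; lra.
Qed.

(** Negative correlation makes a partial sum of a random shuffle at most as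
    spread out as a sum of independent draws. *)
Lemma sampling_second_moment (P : pred 'I_n) :
  mean (fun s : 'S_n => sqn (\sum_(j | P j) a (s j)))
    <= #|P|%:R ^+ 2 * sqn g + #|P|%:R * var.
Proof.
rewrite (eq_mean (_ : _ =1 fun s : 'S_n =>
    \sum_(j | P j) \sum_(k | P k) dot (a (s j)) (a (s k)))); last first.
  by move=> s; rewrite dot_suml; apply: eq_bigr => j _; rewrite dot_sumr.
rewrite mean_sum.
apply: (@le_trans _ _ (\sum_(j | P j) (#|P|%:R * sqn g + var))); last first.
  by rewrite sumr_const -[X in X <= _]mulr_natl mulrDr expr2 mulrA.
apply: ler_sum => j Pj; rewrite mean_sum.
rewrite (bigD1 j)//= -/(pair j j) pair_diag.
rewrite [_%:R * _]mulr_natl -sumr_const (bigD1 j Pj) /=.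
rewrite addrAC lerD2r lerD2l; apply: ler_sum => k /andP[_ kj].
exact: pair_off.
Qed.

End Shuffling.

Lemma sum_partial_sampling (R : realType) (n d : nat) (a : 'I_n -> 'rV[R]_d)
    (V : R) : (0 < n)%N ->
  n%:R^-1 * \sum_i sqn (a i - n%:R^-1 *: \sum_k a k) <= V ->
  \sum_(i < n.+1) mean (fun s : 'S_n => sqn (\sum_(j < n | (j < i)%N) a (s j)))
    <= n%:R ^+ 2 * (n%:R * sqn (n%:R^-1 *: \sum_k a k) + V).
Proof.
move=> n0; set g := n%:R^-1 *: _ => varV.
have V0 : 0 <= V.
  apply: le_trans varV; rewrite mulr_ge0 ?invr_ge0//.
  by apply: sumr_ge0 => i _; exact: sqn_ge0.
rewrite big_ord_recl (eq_mean (_ : _ =1 fun=> 0)); last first.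
  by move=> s; rewrite big1 ?dot0l.
rewrite (mean_cst (1%g : 'S_n)) add0r.
have -> : n%:R ^+ 2 * (n%:R * sqn g + V) =
    \sum_(i < n) n%:R * (n%:R * sqn g + V).
  by rewrite sumr_const card_ord -[RHS]mulr_natl expr2 mulrA.
apply: ler_sum => i _.
set P := fun j : 'I_n => (j < lift ord0 i)%N.
apply: (le_trans (sampling_second_moment a P)).
have Pn : #|P|%:R <= n%:R :> R by rewrite ler_nat (leq_trans (max_card _))// card_ord.
rewrite [leRHS]mulrDr; apply: lerD.
  by rewrite (mulrA n%:R) -expr2 ler_wpM2r ?sqn_ge0// lerXn2r ?nnegrE.
apply: (@le_trans _ _ (#|P|%:R * V)); first by rewrite ler_wpM2l.
by rewrite ler_wpM2r.
Qed.

(** Conditioning on the first coordinate of a uniform tuple. *)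
Lemma mean_tuple_cons (R : realType) (T : finType) (K : nat)
    (X : K.+1.-tuple T -> R) :
  mean X = mean (fun t => mean (fun s : K.-tuple T => X [tuple of t :: s])).
Proof.
rewrite /mean -mulr_sumr mulrA !card_tuple expnS natrM invfM; congr (_ * _).
rewrite pair_big /=.
rewrite (reindex (fun p : T * K.-tuple T => [tuple of p.1 :: p.2])) //=.
exists (fun s : K.+1.-tuple T => (thead s, [tuple of behead s])) => [[t s] _|s _] /=.
  by rewrite theadE; congr pair; apply/val_inj.
by rewrite -tuple_eta.
Qed.

(** * The displacement over one epoch *)

Section Epoch.
Variables (R : realType) (n dx dy : nat) (F : 'I_n -> 'rV[R]_(dx + dy) -> R).
Variables (L alpha beta : R) (v : variant).
Hypothesis n0 : (0 < n)%N.
Hypothesis LF : forall i z w,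
  sqn (grad (F i) z - grad (F i) w) <= L ^+ 2 * sqn (z - w).
Hypothesis gradf : forall z, grad (favg F) z = n%:R^-1 *: \sum_i grad (F i) z.
Lemma grad1_favg z : grad1 (favg F) z = n%:R^-1 *: \sum_i grad1 (F i) z.
Proof. by rewrite /grad1 gradf linearZ linear_sum. Qed.

Lemma grad2_favg z : grad2 (favg F) z = n%:R^-1 *: \sum_i grad2 (F i) z.
Proof. by rewrite /grad2 gradf linearZ linear_sum. Qed.

Hypotheses (alpha0 : 0 <= alpha) (alpha_beta : alpha <= beta).
Hypothesis small : 36 * (L ^+ 2 * beta ^+ 2 * n%:R ^+ 2) <= 1.

(** Were all gradients evaluated at the starting point [z], this would be the
    sum over the epoch of the squared distances to [z]. *)
Definition anchored_drift (z : 'rV[R]_(dx + dy)) (s : 'S_n) : R :=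
  \sum_(i < n.+1)
    (alpha ^+ 2 * sqn (\sum_(j < n | (j < i)%N) grad1 (F (s j)) z) +
     beta ^+ 2 * sqn (\sum_(j < n | (j < i)%N) grad2 (F (s j)) z)).

Section One_epoch.
Variables (z0 : 'rV[R]_(dx + dy)) (s : 'S_n).

Let zs (i : nat) : 'rV[R]_(dx + dy) :=
  foldl (sgda_step v alpha beta) z0 (take i [seq F (s j) | j <- enum 'I_n]).

Let zs0 : zs 0 = z0.
Proof. by rewrite /zs take0. Qed.

Let zsn : zs n = sgda_epoch F v alpha beta z0 s.
Proof. by rewrite /zs take_oversize// size_map size_enum_ord. Qed.

Let zsS (j : 'I_n) : zs j.+1 = sgda_step v alpha beta (zs j) (F (s j)).
Proof.
rewrite /zs (take_nth (F (s j))); last by rewrite size_map size_enum_ord.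
rewrite foldl_rcons; congr sgda_step.
have /= -> := nth_map j (F (s j)) (fun k => F (s k)) (_ : (j < size (enum 'I_n))%N).
  by rewrite nth_ord_enum.
by rewrite size_enum_ord.
Qed.

(** The point where [grad2] is evaluated: the two variants of the algorithm
    differ only here, and in [sqn_w]. *)
Let zmid (j : nat) : 'rV[R]_(dx + dy) :=
  match v with
  | simSGDA => zs j
  | altSGDA => row_mx (lsubmx (zs j.+1)) (rsubmx (zs j))
  end.

Let D (i : nat) : R := sqn (zs i - z0).
Let D_ge0 i : 0 <= D i. Proof. exact: sqn_ge0. Qed.
Let u (j : 'I_n) := grad1 (F (s j)) (zs j) - grad1 (F (s j)) z0.
Let w (j : 'I_n) := grad2 (F (s j)) (zmid j) - grad2 (F (s j)) z0.
Let T : R := \sum_(i < n.+1) D i.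

Let zs_incr (j : 'I_n) : zs j.+1 = zs j +
  row_mx (- alpha *: grad1 (F (s j)) (zs j)) (beta *: grad2 (F (s j)) (zmid j)).
Proof.
have x1 : lsubmx (zs j.+1) = lsubmx (zs j) - alpha *: grad1 (F (s j)) (zs j).
  by rewrite zsS row_mxKl.
rewrite -[X in _ = X + _]hsubmxK add_row_mx scaleNr /zmid x1 zsS /sgda_step.
by case: v; rewrite ?hsubmxK.
Qed.

Let sqn_u j : sqn (u j) <= L ^+ 2 * D j.
Proof.
apply: le_trans (LF (s j) (zs j) z0); rewrite [leRHS]sqn_split.
by rewrite linearB /= lerDl sqn_ge0.
Qed.

(** The [x] part of [zmid j] may already be that of step [j.+1]; paying for both
    [D j] and [D j.+1] covers the two variants at once. *)
Let sqn_w (j : 'I_n) : sqn (w j) <= L ^+ 2 * (D j + D j.+1).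
Proof.
apply: (@le_trans _ _ (L ^+ 2 * sqn (zmid j - z0))).
  apply: le_trans (LF (s j) (zmid j) z0); rewrite [leRHS]sqn_split.
  by rewrite (linearB rsubmx) /= lerDr sqn_ge0.
rewrite ler_wpM2l ?sqr_ge0// /zmid /D; case: v; first by rewrite lerDl sqn_ge0.
rewrite (sqn_splitB (row_mx _ _)) row_mxKl row_mxKr.
rewrite (sqn_splitB (zs j)) (sqn_splitB (zs j.+1)).
set a := sqn (lsubmx (zs j.+1) - _); set b := sqn (rsubmx (zs j) - _).
have := sqn_ge0 (lsubmx (zs j) - lsubmx z0).
have := sqn_ge0 (rsubmx (zs j.+1) - rsubmx z0).
lra.
Qed.

Let sum_D : \sum_(j < n) D j <= T.
Proof. by rewrite /T big_ord_recr /= lerDl. Qed.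

Let sum_DS : \sum_(j < n) D j.+1 <= T.
Proof. by rewrite /T big_ord_recl lerDr. Qed.

Let zs_sum i : (i <= n)%N -> zs i - z0 = \sum_(j < n | (j < i)%N)
  row_mx (- alpha *: grad1 (F (s j)) (zs j)) (beta *: grad2 (F (s j)) (zmid j)).
Proof.
elim: i => [_|i IH lin]; first by rewrite zs0 subrr big1.
rewrite (bigD1 (Ordinal lin)) //= (zs_incr (Ordinal lin)) /= addrAC.
rewrite (IH (ltnW lin)) addrC; congr (_ + _); apply: eq_bigl => j.
by rewrite -val_eqE /= ltnS [in RHS]andbC -ltn_neqAle.
Qed.

Let T_ge0 : 0 <= T.
Proof. by apply: sumr_ge0. Qed.

Let sum_w : \sum_j sqn (w j) <= 2 * L ^+ 2 * T.
Proof.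
apply: (@le_trans _ _ (\sum_(j < n) L ^+ 2 * (D j + D j.+1))).
  by apply: ler_sum => j _.
rewrite -mulr_sumr big_split /= -mulrA mulrCA ler_wpM2l ?sqr_ge0//.
by have := sum_D; have := sum_DS; lra.
Qed.

Let sum_u : \sum_j sqn (u j) <= L ^+ 2 * T.
Proof.
apply: (@le_trans _ _ (\sum_(j < n) L ^+ 2 * D j)).
  by apply: ler_sum => j _.
by rewrite -mulr_sumr ler_wpM2l ?sqr_ge0.
Qed.

(** The displacement is the anchored one plus the accumulated error [U] of the
    gradients, and [U] is itself controlled by [T]. The step size is small
    enough for this feedback term to be absorbed in the left-hand side. *)
Let T_le : T <= 2 * anchored_drift z0 s.
Proof.
pose U (i : nat) := \sum_(j < n | (j < i)%N) row_mx (- alpha *: u j) (beta *: w j).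
pose A (i : nat) := \sum_(j < n | (j < i)%N)
  row_mx (- alpha *: grad1 (F (s j)) z0) (beta *: grad2 (F (s j)) z0).
have zAU i : (i <= n)%N -> zs i - z0 = A i + U i.
  move=> lin; rewrite zs_sum// -big_split; apply: eq_bigr => j _ /=.
  by rewrite add_row_mx -!scalerDr !(addrC (grad1 _ z0)) !(addrC (grad2 _ z0)) !subrK.
have sqA i : sqn (A i) =
    alpha ^+ 2 * sqn (\sum_(j < n | (j < i)%N) grad1 (F (s j)) z0) +
    beta ^+ 2 * sqn (\sum_(j < n | (j < i)%N) grad2 (F (s j)) z0).
  rewrite sqn_split /A !linear_sum /=.
  under eq_bigr do rewrite row_mxKl.
  under [X in _ + sqn X]eq_bigr do rewrite row_mxKr.
  by rewrite -!scaler_sumr !sqnZ sqrrN.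
have ab : alpha ^+ 2 <= beta ^+ 2 by rewrite lerXn2r ?nnegrE// (le_trans alpha0).
have sqU i : sqn (U i) <= n%:R * (3 * (L ^+ 2 * beta ^+ 2) * T).
  apply: (le_trans (sqn_sum_le _ _)).
  have le1 : \sum_(j < n | (j < i)%N) sqn (row_mx (- alpha *: u j) (beta *: w j))
      <= 3 * (L ^+ 2 * beta ^+ 2) * T.
    apply: (@le_trans _ _ (\sum_j (beta ^+ 2 * sqn (u j) + beta ^+ 2 * sqn (w j)))).
      rewrite big_mkcond /=; apply: ler_sum => j _.
      have bu : 0 <= beta ^+ 2 * sqn (u j) by rewrite mulr_ge0 ?sqr_ge0 ?sqn_ge0.
      have bw : 0 <= beta ^+ 2 * sqn (w j) by rewrite mulr_ge0 ?sqr_ge0 ?sqn_ge0.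
      case: ifP => _; last exact: addr_ge0.
      by rewrite sqn_row_mx !sqnZ sqrrN lerD2r ler_wpM2r ?sqn_ge0.
    rewrite big_split /= -!mulr_sumr -mulrDr.
    have -> : 3 * (L ^+ 2 * beta ^+ 2) * T = beta ^+ 2 * (3 * L ^+ 2 * T) by ring.
    by rewrite ler_wpM2l ?sqr_ge0//; have := sum_u; have := sum_w; lra.
  apply: ler_pM => //; first by apply: sumr_ge0 => j _; exact: sqn_ge0.
  by rewrite ler_nat (leq_trans (max_card _))// card_ord.
have sumU : \sum_(i < n.+1) sqn (U i)
    <= n%:R * (n%:R * (3 * (L ^+ 2 * beta ^+ 2) * T)).
  rewrite big_ord_recl {1}/U big1 ?dot0l ?add0r => [|//].
  set X := n%:R * (3 * _ * T).
  have -> : n%:R * X = \sum_(i < n) X by rewrite sumr_const card_ord mulr_natl.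
  by apply: ler_sum => i _; exact: sqU.
(* weights 3/2 and 3: the feedback 3 * T / 12 leaves 3/4 T on the left *)
have half : 0 < 2^-1 :> R by rewrite invr_gt0.
have TAU : T <= 3 / 2 * anchored_drift z0 s + 3 * \sum_(i < n.+1) sqn (U i).
  rewrite /anchored_drift !mulr_sumr -big_split; apply: ler_sum => i _ /=.
  have lin : (i <= n)%N by rewrite -ltnS.
  have := sqnD_le (A i) (U i) half; rewrite -(zAU i lin) sqA invrK -/(D i).
  by lra.
have : n%:R * (n%:R * (3 * (L ^+ 2 * beta ^+ 2) * T)) <= 12^-1 * T.
  have -> : n%:R * (n%:R * (3 * (L ^+ 2 * beta ^+ 2) * T)) =
    12^-1 * T * (36 * (L ^+ 2 * beta ^+ 2 * n%:R ^+ 2)) by field.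
  by rewrite ler_piMr// mulr_ge0// invr_ge0.
lra.
Qed.

(** An epoch is one full gradient step of length [n] times the step size, up to
    errors [e1], [e2]: summing over a whole epoch visits every component once,
    so the order of visit matters only through the errors. *)
Lemma epoch_increment : exists e1 e2,
  [/\ sgda_epoch F v alpha beta z0 s =
      row_mx (lsubmx z0 - (n%:R * alpha) *: (grad1 (favg F) z0 + e1))
             (rsubmx z0 + (n%:R * beta) *: (grad2 (favg F) z0 + e2)),
      sqn e1 <= 2 * (L ^+ 2 / n%:R * anchored_drift z0 s) &
      sqn e2 <= 4 * (L ^+ 2 / n%:R * anchored_drift z0 s)].
Proof.
have nn0 : n%:R != 0 :> R by rewrite pnatr_eq0 -lt0n.
have n_gt0 : 0 < n%:R :> R by rewrite ltr0n.
have sum_p : \sum_j grad1 (F (s j)) (zs j) =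
    n%:R *: (grad1 (favg F) z0 + n%:R^-1 *: \sum_j u j).
  rewrite grad1_favg -scalerDr scalerA divff// scale1r.
  rewrite [X in X + _](reindex_inj (@perm_inj _ s)) -big_split.
  by apply: eq_bigr => j _; rewrite /= addrC subrK.
have sum_q : \sum_j grad2 (F (s j)) (zmid j) =
    n%:R *: (grad2 (favg F) z0 + n%:R^-1 *: \sum_j w j).
  rewrite grad2_favg -scalerDr scalerA divff// scale1r.
  rewrite [X in X + _](reindex_inj (@perm_inj _ s)) -big_split.
  by apply: eq_bigr => j _; rewrite /= addrC subrK.
exists (n%:R^-1 *: \sum_j u j), (n%:R^-1 *: \sum_j w j); split.
- rewrite -zsn -[LHS](subrK z0) (zs_sum (leqnn n)) addrC.
  rewrite -{1}(hsubmxK z0).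
  have -> : \sum_(j < n | (j < n)%N) row_mx (- alpha *: grad1 (F (s j)) (zs j))
     (beta *: grad2 (F (s j)) (zmid j)) =
     row_mx (- alpha *: \sum_j grad1 (F (s j)) (zs j))
            (beta *: \sum_j grad2 (F (s j)) (zmid j)).
    rewrite (eq_bigl xpredT) => [|j]; last by rewrite ltn_ord.
    rewrite -[LHS]hsubmxK !linear_sum /=; congr row_mx; rewrite ?scaler_sumr.
      by apply: eq_bigr => j _; rewrite row_mxKl.
    by apply: eq_bigr => j _; rewrite row_mxKr.
  by rewrite add_row_mx sum_p sum_q !scalerA !(mulrC _ n%:R) mulrN scaleNr.
- rewrite sqnZ -ler_pdivlMl ?exprn_gt0 ?invr_gt0//.
  apply: (le_trans (sqn_sum_le _ _)); rewrite card_ord.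
  apply: (@le_trans _ _ (n%:R * (L ^+ 2 * (2 * anchored_drift z0 s)))).
    rewrite ler_wpM2l//; apply: (le_trans sum_u); rewrite ler_wpM2l ?sqr_ge0//.
  by rewrite le_eqVlt; apply/orP; left; apply/eqP; field.
- rewrite sqnZ -ler_pdivlMl ?exprn_gt0 ?invr_gt0//.
  apply: (le_trans (sqn_sum_le _ _)); rewrite card_ord.
  apply: (@le_trans _ _ (n%:R * (2 * L ^+ 2 * (2 * anchored_drift z0 s)))).
    rewrite ler_wpM2l//; apply: (le_trans sum_w).
    by apply: ler_wpM2l => //; apply: mulr_ge0 => //; exact: sqr_ge0.
  by rewrite le_eqVlt; apply/orP; left; apply/eqP; field.
Qed.

End One_epoch.
End Epoch.

(** * Descent of the Lyapunov function *)

Section Descent.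
Variables (R : realType) (n dx dy : nat) (F : 'I_n -> 'rV[R]_(dx + dy) -> R).
Variables (L A B mu r beta m : R) (v : variant).
Let f := favg F.
Let alpha := beta / r.
Let kappa := L / mu.
Hypothesis n0 : (0 < n)%N.
Hypothesis L0 : 0 < L.
Hypothesis dF : forall i z, differentiable (F i) z.
Hypothesis LF : forall i z w,
  sqn (grad (F i) z - grad (F i) w) <= L ^+ 2 * sqn (z - w).
Hypotheses (A0 : 0 <= A) (B0 : 0 <= B).
Hypothesis var1 : forall z,
  n%:R^-1 * \sum_i sqn (grad1 (F i) z - grad1 f z) <= A * sqn (grad1 f z) + B.
Hypothesis var2 : forall z,
  n%:R^-1 * \sum_i sqn (grad2 (F i) z - grad2 f z) <= A * sqn (grad2 f z) + B.
Hypothesis amax : forall x, argmax2 f x !=set0.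
Hypothesis Phi_m : forall x, m <= Phi f x.
Hypotheses (mu0 : 0 < mu) (muL : mu <= L).
Hypothesis PL : forall z, 2 * mu * (Phi f (lsubmx z) - f z) <= sqn (grad2 f z).
Hypothesis r_ge : 14 * kappa ^+ 2 <= r.
Hypothesis beta0 : 0 <= beta.
Hypothesis step : 36 * (L ^+ 2 * beta ^+ 2 * (n%:R * (n%:R + A))) <= 1.

Let gradf z := grad_favg dF z.
Let df := differentiable_favg dF.
Let Lf := lipschitz_grad_favg n0 dF LF.
Let N : R := n%:R.
Let N0 : 0 < N. Proof. by rewrite ltr0n. Qed.
Let N_ge0 : 0 <= N. Proof. exact: ltW. Qed.
Let kappa1 : 1 <= kappa. Proof. by rewrite ler_pdivlMr// mul1r. Qed.
Let r14 : 14 <= r.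
Proof.
apply: le_trans r_ge; rewrite ler_peMr// -{1}(expr1n _ 2).
by rewrite lerXn2r ?nnegrE// (le_trans ler01).
Qed.
Let r0 : 0 < r. Proof. by apply: lt_le_trans r14. Qed.
Let alpha0 : 0 <= alpha. Proof. by rewrite divr_ge0// ltW. Qed.
Let alpha_beta : alpha <= beta.
Proof. by rewrite ler_pdivrMr// ler_peMr//; move: r14; lra. Qed.

Let small : 36 * (L ^+ 2 * beta ^+ 2 * n%:R ^+ 2) <= 1.
Proof.
apply: le_trans step; rewrite ler_wpM2l//; apply: ler_wpM2l.
  by rewrite mulr_ge0 ?sqr_ge0.
by rewrite expr2; apply: ler_wpM2l; rewrite ?lerDl.
Qed.

(** The step condition keeps [n beta] below [1 / (6 L)], and [r >= 14 kappa^2]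
    keeps [n alpha] below [1 / (42 LPhi)] with [LPhi = L (1 + kappa)]. *)
Let Lb : 6 * (L * (N * beta)) <= 1.
Proof.
rewrite -(@ler_pXn2r _ 2) ?nnegrE ?expr1n//; last first.
  by rewrite !mulr_ge0// ltW.
by apply: le_trans small; rewrite le_eqVlt; apply/orP; left; apply/eqP; rewrite /N; ring.
Qed.

Let La : 42 * ((L + L ^+ 2 / mu) * (N * alpha)) <= 1.
Proof.
have -> : 42 * ((L + L ^+ 2 / mu) * (N * alpha)) =
  6 * (L * (N * beta)) * (7 * (1 + kappa) / r).
  by rewrite /alpha /kappa; field; rewrite !gt_eqF.
have k0 : 0 <= 7 * (1 + kappa) / r.
  by rewrite divr_ge0 ?(ltW r0)// mulr_ge0//; move: kappa1; lra.
apply: (@le_trans _ _ (7 * (1 + kappa) / r)).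
  by rewrite ler_piMl.
rewrite ler_pdivrMr// mul1r; apply: le_trans r_ge; move: kappa1; nra.
Qed.

(** The potential with weight 3/2 on the primal gap instead of 4. It is smaller
    than the latter, and the lighter weight is what leaves room for the factor 3
    in [grad_Phi_gap] given only [r >= 14 kappa^2]. *)
Definition lyapunov (z : 'rV[R]_(dx + dy)) : R :=
  3 / 2 * (Phi f (lsubmx z) - m) + (Phi f (lsubmx z) - f z).

Lemma lyapunov_ge0 z : 0 <= lyapunov z.
Proof.
rewrite addr_ge0//; first by rewrite mulr_ge0// subr_ge0.
by rewrite subr_ge0 -{1}(hsubmxK z); exact: le_Phi.
Qed.

Let P (z : 'rV[R]_(dx + dy)) := sqn (grad (Phi f) (lsubmx z)).

(** The upper model of [Phi] and the lower model of [f] along the increment of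
    the epoch. The inner products are expanded by polarization, so that the
    negative squares of the actual steps [p1], [p2] pay for the second-order
    terms; the errors cost [44 / 7 * r * L^2 / N] times the drift. *)
Lemma epoch_descent_pathwise z s :
  lyapunov (sgda_epoch F v alpha beta z s) <= lyapunov z
   + N * alpha / 2 * (- (5 / 2) * P z
       + 25 / 8 * sqn (grad (Phi f) (lsubmx z) - grad1 f z)
       - r * sqn (grad2 f z)
       + 44 / 7 * r * (L ^+ 2 / N * anchored_drift F alpha beta z s)).
Proof.
have [e1 [e2 [zE e1le e2le]]] :=
  epoch_increment v n0 LF gradf alpha0 alpha_beta small z s.
rewrite zE /lyapunov row_mxKl.
set x := lsubmx z; set y := rsubmx z; rewrite -/f -/N in e1le e2le *.
set G := grad (Phi f) x; set g1 := grad1 f z; set g2 := grad2 f z.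
set p1 := g1 + e1; set p2 := g2 + e2.
set Q := L ^+ 2 / N * _ in e1le e2le *.
set a := N * alpha; set b := N * beta.
have a0 : 0 <= a by rewrite mulr_ge0.
have b0 : 0 <= b by rewrite mulr_ge0.
have bE : b = r * a by rewrite /b /a /alpha; field; rewrite gt_eqF.
have Lba : 6 * (L * b) <= 1 := Lb.
have Laa : 42 * ((L + L ^+ 2 / mu) * a) <= 1 := La.
have up := Phi_upper L0 mu0 df Lf amax PL x (- (a *: p1)).
have lo := quad_lower L0 df Lf z (row_mx (- (a *: p1)) (b *: p2)).
have zE' : z + row_mx (- (a *: p1)) (b *: p2) = row_mx (x - a *: p1) (y + b *: p2).
  by rewrite -{1}(hsubmxK z) add_row_mx.
rewrite zE' sqn_row_mx dot_grad in lo.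
rewrite dotNr dotZr sqnN sqnZ in up.
rewrite dotNr (dotZr a g1) (dotZr b g2) sqnN !sqnZ in lo.
rewrite -/f -/g1 -/g2 in lo; rewrite -/f -/G in up.
(* the Young weights 1/4 and 2/5 keep the coefficient of sqn p1, which is
   - 5/2 + 12/5 + (5/2) / 42 + 1 / 42, negative *)
have h1 : - (2 * dot G p1) <= 5 / 4 * sqn (G - g1) + 5 * sqn e1 - sqn G - sqn p1.
  have q : 0 < 4^-1 :> R by rewrite invr_gt0.
  have := sqnD_le (G - g1) (- e1) q; rewrite sqnN invrK.
  have -> : G - g1 - e1 = G - p1 by rewrite /p1 opprD addrA.
  by rewrite sqnB; lra.
have h2 : 2 * dot g1 p1 <= 12 / 5 * sqn p1 + 7 / 2 * sqn e1.
  have q : 0 < 2 / 5 :> R by rewrite divr_gt0.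
  have := sqnD_le p1 (- e1) q; rewrite sqnN.
  have -> : p1 - e1 = g1 by rewrite /p1 addrK.
  have -> : 1 + (2 / 5)^-1 = 7 / 2 :> R by field.
  have := sqn_ge0 (g1 - p1); rewrite sqnB; lra.
have h3 : - (2 * dot g2 p2) = sqn e2 - sqn g2 - sqn p2.
  have -> : e2 = p2 - g2 by rewrite /p2 addrC addKr.
  by rewrite sqnB (dotC p2); ring.
have N1_0 : 0 <= sqn p1 := sqn_ge0 p1.
have N2_0 : 0 <= sqn p2 := sqn_ge0 p2.
have Q0 : 0 <= Q by have := sqn_ge0 e1; lra.
have k1 : a / 2 * (42 * ((L + L ^+ 2 / mu) * a)) * sqn p1 <= a / 2 * sqn p1.
  by rewrite ler_wpM2r// ler_piMr// divr_ge0.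
have k1' : a / 2 * (42 * (L * a)) * sqn p1 <= a / 2 * sqn p1.
  apply: le_trans k1; rewrite ler_wpM2r// ler_wpM2l ?divr_ge0// ler_wpM2l//.
  by rewrite ler_wpM2r// lerDl divr_ge0 ?sqr_ge0// ltW.
have k2 : b / 2 * (6 * (L * b)) * sqn p2 <= b / 2 * sqn p2.
  by rewrite ler_wpM2r// ler_piMr// divr_ge0.
have H1 := ler_wpM2l (divr_ge0 a0 (ler0n R 2)) h1.
have H2 := ler_wpM2l (divr_ge0 a0 (ler0n R 2)) h2.
have H4 : a / 2 * sqn e1 <= a / 2 * (2 * Q) by rewrite ler_wpM2l// divr_ge0.
have H5 : b / 2 * sqn e2 <= b / 2 * (4 * Q) by rewrite ler_wpM2l// divr_ge0.
have H6 : a / 2 * (14 * Q) <= a / 2 * (r * Q).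
  by rewrite ler_wpM2l ?divr_ge0// ler_wpM2r.
have H7 : 0 <= a * sqn p1 by rewrite mulr_ge0.
have H8 : 0 <= b * sqn p2 by rewrite mulr_ge0.
have H3 : - (b * dot g2 p2) = b / 2 * (sqn e2 - sqn g2 - sqn p2).
  by rewrite -h3; field.
have bg : b * sqn g2 = a * (r * sqn g2) by rewrite bE; ring.
have bQ : b * Q = a * (r * Q) by rewrite bE; ring.
rewrite -/(P z) /P -/x -/G.
lra.
Qed.

(** Each of the [n] partial sums contributes at most [n^2] times the squared
    mean plus [n] times the variance. *)
Lemma mean_anchored_drift z :
  mean (anchored_drift F alpha beta z) <=
    alpha ^+ 2 * (N ^+ 2 * ((N + A) * sqn (grad1 f z) + B)) +
    beta ^+ 2 * (N ^+ 2 * ((N + A) * sqn (grad2 f z) + B)).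
Proof.
have v1 := var1 z; rewrite /f (grad1_favg gradf) in v1.
have v2 := var2 z; rewrite /f (grad2_favg gradf) in v2.
have s1 := sum_partial_sampling n0 v1; have s2 := sum_partial_sampling n0 v2.
rewrite -(grad1_favg gradf) -/f in s1; rewrite -(grad2_favg gradf) -/f in s2.
rewrite /anchored_drift mean_sum.
under eq_bigr do rewrite meanD !meanZ.
rewrite big_split /= -[X in X + _ <= _]mulr_sumr -[X in _ + X <= _]mulr_sumr.
apply: lerD; rewrite ler_wpM2l ?sqr_ge0//.
  by apply: (le_trans s1); rewrite ler_wpM2l ?sqr_ge0// /N; lra.
by apply: (le_trans s2); rewrite ler_wpM2l ?sqr_ge0// /N; lra.
Qed.

(** In the mean, the drift costs [44 / 7 / 36] of [r sqn (grad2 f z)] and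
    [grad_Phi_gap] costs [25 / 8 * 3 / 14] of it, in total less than 1. So the
    dual gradient absorbs both, up to the part due to [B] and a small multiple
    of [P z]. *)
Lemma epoch_descent z :
  mean (fun s => lyapunov (sgda_epoch F v alpha beta z s)) <=
    lyapunov z - N * alpha * P z
    + N * alpha * (7 * (r * (L ^+ 2 * N * beta ^+ 2 * B))).
Proof.
apply: (le_trans (mean_le (epoch_descent_pathwise z))).
set d := sqn (_ - _); set g2 := sqn (grad2 f z).
rewrite meanD (mean_cst (1%g : 'S_n)) meanZ meanD (mean_cst (1%g : 'S_n)) !meanZ.
rewrite -[leRHS]addrA lerD2l -mulrN.
set M := mean _.
have Mle := mean_anchored_drift z; rewrite -/M -/g2 in Mle.
set g1 := sqn (grad1 f z) in Mle.
have g10 : 0 <= g1 by exact: sqn_ge0.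
have g20 : 0 <= g2 by exact: sqn_ge0.
have d0 : 0 <= d by exact: sqn_ge0.
have P0 : 0 <= P z by exact: sqn_ge0.
pose b := L ^+ 2 * N * beta ^+ 2 * B.
have b0 : 0 <= b by rewrite /b !mulr_ge0// ?sqr_ge0// ltW.
have dg2 : 14 * d <= 3 * (r * g2).
  have := grad_Phi_gap L0 mu0 df Lf amax PL z muL; rewrite -/d -/g2 -/kappa => h.
  have := ler_wpM2r g20 r_ge; lra.
have g1P : g1 <= 2 * P z + 2 * d.
  have := sqnD_le (grad (Phi f) (lsubmx z))
    (- (grad (Phi f) (lsubmx z) - grad1 f z)) (ltr01 : 0 < 1 :> R).
  by rewrite subKr sqnN invr1 -/d -/(P z) -/g1; lra.
have rM : r * (L ^+ 2 / N * M) <= 36^-1 * (g1 / r + r * g2) + 2 * (r * b).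
  set c := 36 * (L ^+ 2 * beta ^+ 2 * (N * (N + A))).
  apply: (@le_trans _ _ (r * (L ^+ 2 / N * (
    alpha ^+ 2 * (N ^+ 2 * ((N + A) * g1 + B)) +
    beta ^+ 2 * (N ^+ 2 * ((N + A) * g2 + B)))))).
    rewrite ler_wpM2l ?(ltW r0)// ler_wpM2l// divr_ge0 ?sqr_ge0// ltW//.
  have -> : r * (L ^+ 2 / N * (alpha ^+ 2 * (N ^+ 2 * ((N + A) * g1 + B)) +
    beta ^+ 2 * (N ^+ 2 * ((N + A) * g2 + B)))) =
    c * (36^-1 * (g1 / r + r * g2)) + (r + r^-1) * b.
    by rewrite /c /b /alpha; field; rewrite !gt_eqF.
  apply: lerD.
    by rewrite ler_piMl// mulr_ge0 ?invr_ge0// addr_ge0// ?divr_ge0 ?mulr_ge0// ltW.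
  rewrite mulrA ler_wpM2r// mulr_natl mulr2n lerD2l.
  have r1 : 1 <= r by move: r14; lra.
  by apply: le_trans r1; rewrite invf_le1//; move: r14; lra.
have g1r : g1 / r <= 14^-1 * g1.
  by rewrite mulrC ler_wpM2r// lef_pV2 ?posrE.
have rg2 : 0 <= r * g2 by rewrite mulr_ge0// ltW.
have rb : 0 <= r * b by rewrite mulr_ge0// ltW.
rewrite [leRHS](_ : _ = N * alpha / 2 * (- (2 * P z) + 14 * (r * b))); last first.
  by rewrite /b; field.
apply: ler_wpM2l; first by apply: divr_ge0 => //; exact: mulr_ge0.
lra.
Qed.

(** Induction on the number of epochs for all starting points at once, peeling
    off the first epoch, so that no conditional expectation is needed. *)
Lemma telescope K z :
  N * alpha * \sum_(k < K) mean (fun s : K.-tuple 'S_n =>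
      P (sgda_epochs F v alpha beta z (take k s)))
  <= lyapunov z + K%:R * (N * alpha * (7 * (r * (L ^+ 2 * N * beta ^+ 2 * B)))).
Proof.
elim: K z => [|K IH] z.
  by rewrite big_ord0 mulr0 mul0r addr0 lyapunov_ge0.
have -> : \sum_(k < K.+1) mean (fun s : K.+1.-tuple 'S_n =>
     P (sgda_epochs F v alpha beta z (take k s))) =
   P z + mean (fun t => \sum_(k < K) mean (fun s : K.-tuple 'S_n =>
     P (sgda_epochs F v alpha beta (sgda_epoch F v alpha beta z t) (take k s)))).
  rewrite big_ord_recl; congr (_ + _).
    rewrite -[RHS](mean_cst [tuple of nseq K.+1 (1%g : 'S_n)]).
    by apply: eq_mean => s; rewrite take0.
  rewrite mean_sum; apply: eq_bigr => k _; rewrite mean_tuple_cons.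
  by apply: eq_mean.
rewrite mulrDr -meanZ.
have h := mean_le (fun t => IH (sgda_epoch F v alpha beta z t)).
have := epoch_descent z.
rewrite meanD (mean_cst (1%g : 'S_n)) in h.
rewrite -natr1 mulrDl mul1r; lra.
Qed.

End Descent.

(** * The choice of the step size *)

Lemma cube_rootK (R : realType) (x : R) : 0 <= x -> (x ^+ 3) `^ 3^-1 = x.
Proof.
by move=> x0; rewrite -powR_mulrn// -powRrM mulfV ?powRr1// pnatr_eq0.
Qed.

Lemma root_cubeK (R : realType) (x : R) : 0 <= x -> (x `^ 3^-1) ^+ 3 = x.
Proof.
by move=> x0; rewrite -powR_mulrn ?powR_ge0// -powRrM mulVf ?powRr1// pnatr_eq0.
Qed.

(** The step size [q] is the one for which the initial potential term
    [V / (K N q)] and the noise term [L^2 B N q^2] coincide; their common value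
    is the second term of the rate. *)
Lemma noise_balance (R : realType) (L B N K q : R) : 
  0 < L -> 0 <= B -> 0 < N -> 0 < K -> 0 <= q ->
  let V := q ^+ 3 * (L ^+ 2 * B * N ^+ 2 * K) in
  (L ^+ 2 * B * V ^+ 2 / (N * K ^+ 2)) `^ 3^-1 = L ^+ 2 * B * N * q ^+ 2.
Proof.
move=> L0 B0 N0 K0 q0 V.
rewrite -[RHS]cube_rootK; last by rewrite !mulr_ge0 ?sqr_ge0// ltW.
by congr (_ `^ _); rewrite /V; field; rewrite !gt_eqF.
Qed.

Section Step_size.
Variables (R : realType) (L A B V : R) (n K : nat).
Hypotheses (L0 : 0 < L) (A0 : 0 <= A) (B0 : 0 <= B) (V0 : 0 <= V).
Hypotheses (n0 : (0 < n)%N) (K0 : (0 < K)%N).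
Let beta := beta_step 1 L A B V n K.
Let N : R := n%:R.
Let N0 : 0 < N. Proof. by rewrite ltr0n. Qed.
Let k0 : 0 < K%:R :> R. Proof. by rewrite ltr0n. Qed.
Let b := (6 * L * Num.sqrt (N * (N + A)))^-1.
Let q := (V / (L ^+ 2 * B * N ^+ 2 * K%:R)) `^ 3^-1.
Let T := (L ^+ 2 * B * V ^+ 2 / (N * K%:R ^+ 2)) `^ 3^-1.

Let NA0 : 0 < N * (N + A). Proof. by rewrite mulr_gt0// ltr_wpDr. Qed.
Let b0 : 0 < b. Proof. by rewrite invr_gt0 !mulr_gt0// sqrtr_gt0. Qed.

Let betaE : beta = if B == 0 then b else Num.min b q.
Proof.
rewrite /beta /beta_step -/N -/b.
have -> : (L ^+ 2 * B * N ^+ 2 * K%:R == 0) = (B == 0).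
  by rewrite !mulf_eq0 (gt_eqF k0) (gt_eqF N0) (gt_eqF L0) !orbF.
by case: ifP => // _; rewrite invr1 mul1r.
Qed.

Lemma beta_step_ge0 : 0 <= beta.
Proof. by rewrite betaE; case: ifP => _; rewrite ?le_min ?powR_ge0 ?andbT ltW. Qed.

Let beta_b : beta <= b.
Proof. by rewrite betaE; case: ifP => // _; rewrite ge_min lexx. Qed.

Lemma beta_step_small : 36 * (L ^+ 2 * beta ^+ 2 * (n%:R * (n%:R + A))) <= 1.
Proof.
have b2 : beta ^+ 2 <= b ^+ 2 by rewrite lerXn2r ?nnegrE ?beta_step_ge0 ?(ltW b0).
apply: (@le_trans _ _ (36 * (L ^+ 2 * b ^+ 2 * (N * (N + A))))).
  by rewrite ler_wpM2l// ler_wpM2r ?(ltW NA0)// ler_wpM2l// sqr_ge0.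
rewrite /b exprVn !exprMn sqr_sqrtr ?(ltW NA0)// le_eqVlt; apply/orP; left.
by apply/eqP; field; rewrite !gt_eqF// ltr_wpDr.
Qed.

Lemma beta_step_gt0 : V != 0 \/ B = 0 -> 0 < beta.
Proof.
move=> VB; rewrite betaE; case: eqP => // /eqP B1.
rewrite lt_min b0 powR_gt0//; case: VB => [Vn0|/eqP]; last by rewrite (negbTE B1).
have Bp : 0 < B by rewrite lt_def B1.
by apply: divr_gt0; [rewrite lt_def Vn0|rewrite !mulr_gt0 ?exprn_gt0].
Qed.

(** The degenerate case: the step sizes vanish and the iterates do not move. *)
Lemma beta_step_eq0 : V = 0 -> B != 0 -> beta = 0.
Proof.
move=> v0 /negbTE B1; rewrite betaE B1 /q v0 mul0r powR0 ?invr_eq0 ?pnatr_eq0//.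
by apply/min_idPr; exact: ltW.
Qed.

Let T_q : B != 0 -> T = L ^+ 2 * B * N * q ^+ 2 /\
  V = q ^+ 3 * (L ^+ 2 * B * N ^+ 2 * K%:R).
Proof.
move=> B1; have Bp : 0 < B by rewrite lt_def B1.
have VE : V = q ^+ 3 * (L ^+ 2 * B * N ^+ 2 * K%:R).
  rewrite root_cubeK; first by field; rewrite !gt_eqF.
  by rewrite divr_ge0// !mulr_ge0 ?sqr_ge0// ltW.
split=> //; rewrite /T {1}VE noise_balance//; exact: powR_ge0.
Qed.

Lemma beta_step_noise : L ^+ 2 * N * beta ^+ 2 * B <= T.
Proof.
have [B1|B1] := eqVneq B 0; first by rewrite B1 mulr0 powR_ge0.
have [-> _] := T_q B1; rewrite mulrAC (mulrAC _ N B) ler_wpM2l//.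
  by rewrite !mulr_ge0 ?sqr_ge0// ltW.
rewrite lerXn2r ?nnegrE ?powR_ge0 ?beta_step_ge0//.
by rewrite betaE (negbTE B1) ge_min lexx orbT.
Qed.

(** [1 / min b q <= 1 / b + 1 / q], where the two summands are the two terms of
    the rate. *)
Lemma beta_step_opt : 0 < beta ->
  V / (K%:R * N * beta) <= 6 * (L * V / K%:R * Num.sqrt (1 + A / N)) + T.
Proof.
move=> beta_gt0.
have T0 : 0 <= T by exact: powR_ge0.
have sE : Num.sqrt (N * (N + A)) = N * Num.sqrt (1 + A / N).
  have -> : N * (N + A) = N ^+ 2 * (1 + A / N) by field; rewrite gt_eqF.
  by rewrite sqrtrM ?sqr_ge0// sqrtr_sqr gtr0_norm.
have bE : V / (K%:R * N * b) = 6 * (L * V / K%:R * Num.sqrt (1 + A / N)).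
  by rewrite /b sE invfM invrK; field; rewrite !gt_eqF.
have b_ge0 : 0 <= V / (K%:R * N * b) by rewrite divr_ge0// !mulr_ge0 ?ltW.
move: beta_gt0; rewrite -bE betaE; case: eqP => [_ _|/eqP B1].
  by rewrite lerDl.
case: (leP b q) => [_ _|_ q0]; first by rewrite lerDl.
suff -> : V / (K%:R * N * q) = T by rewrite lerDr.
by have [-> VE] := T_q B1; rewrite {1}VE; field; rewrite !gt_eqF.
Qed.

End Step_size.

(** * The convergence rate *)

Lemma sgda_step0 (R : realType) (dx dy : nat) v (z : 'rV[R]_(dx + dy)) g :
  sgda_step v 0 0 z g = z.
Proof. by rewrite /sgda_step !scale0r subr0 addr0 hsubmxK. Qed.

Lemma sgda_epochs0 (R : realType) (n dx dy : nat)
    (F : 'I_n -> 'rV[R]_(dx + dy) -> R) v z (sigmas : seq 'S_n) :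
  sgda_epochs F v 0 0 z sigmas = z.
Proof.
elim: sigmas => //= s sigmas.
suff -> : sgda_epoch F v 0 0 z s = z by [].
by rewrite /sgda_epoch; elim: [seq _ | _ <- _] => //= g gs; rewrite sgda_step0.
Qed.

Theorem theorem1 (R : realType) :
  exists c C : R, 0 < c /\ 0 < C /\
  forall (n K dx dy : nat) (F : 'I_n -> 'rV[R]_(dx + dy) -> R)
         (L A B mu2 r : R) (z0 : 'rV[R]_(dx + dy)) (v : variant),
  let f := favg F in
  let kappa2 := L / mu2 in
  let V0 := potential 4 f z0 in
  let beta := beta_step c L A B V0 n K in
  let alpha := beta / r in
  (0 < n)%N -> (0 < K)%N ->
  (* (a) *)
  0 < L ->
  (forall i z, differentiable (F i) z) ->
  (forall i z w, enorm (grad (F i) z - grad (F i) w) <= L * enorm (z - w)) ->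
  (* (b) *)
  0 <= A -> 0 <= B ->
  (forall z, n%:R^-1 * \sum_(i < n) enorm (grad1 (F i) z - grad1 f z) ^+ 2
             <= A * enorm (grad1 f z) ^+ 2 + B) ->
  (forall z, n%:R^-1 * \sum_(i < n) enorm (grad2 (F i) z - grad2 f z) ^+ 2
             <= A * enorm (grad2 f z) ^+ 2 + B) ->
  (* (c) *)
  (forall x, argmax2 f x !=set0 /\ closed (argmax2 f x)) ->
  has_lbound (range (Phi f)) ->
  (* (d); mu2 <= L can only fail when f does not depend on y *)
  0 < mu2 -> mu2 <= L ->
  (forall z, 2 * mu2 * (Phi f (lsubmx z) - f z) <= enorm (grad2 f z) ^+ 2) ->
  14 * kappa2 ^+ 2 <= r ->
  K%:R^-1 * \sum_(k < K)
    Eperm (fun s : K.-tuple 'S_n =>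
      enorm (grad (Phi f)
        (lsubmx (sgda_epochs F v alpha beta z0 (take k s)))) ^+ 2)
  <= C * (r * L * V0 / K%:R * Num.sqrt (1 + A / n%:R)
          + r * (L ^+ 2 * B * V0 ^+ 2 / (n%:R * K%:R ^+ 2)) `^ 3^-1).
Proof.
(* the rate collects 6 from the first step-size bound, and 1 + 7 from the
   second one and the noise *)
exists 1, 8; do 2 split => //.
move=> n K dx dy F L A B mu r z0 v f kappa V beta alpha n0 K0 L0 dF enF A0 B0.
move=> envar1 envar2 amax_closed lbPhi mu0 muL enPL r_ge.
have LF i z w : sqn (grad (F i) z - grad (F i) w) <= L ^+ 2 * sqn (z - w).
  rewrite -!enormE -exprMn lerXn2r ?nnegrE ?mulr_ge0 ?sqrtr_ge0//; exact: ltW.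
have var1 z : n%:R^-1 * \sum_i sqn (grad1 (F i) z - grad1 f z)
    <= A * sqn (grad1 f z) + B.
  by have := envar1 z; rewrite enormE; under eq_bigr do rewrite enormE.
have var2 z : n%:R^-1 * \sum_i sqn (grad2 (F i) z - grad2 f z)
    <= A * sqn (grad2 f z) + B.
  by have := envar2 z; rewrite enormE; under eq_bigr do rewrite enormE.
have PL z : 2 * mu * (Phi f (lsubmx z) - f z) <= sqn (grad2 f z).
  by rewrite -enormE.
have amax x : argmax2 f x !=set0 by have [] := amax_closed x.
have Phi_m x : Phi_min f <= Phi f x by apply: ge_inf => //; exists x.
have k0 : 0 < K%:R :> R by rewrite ltr0n.
have N0 : 0 < n%:R :> R by rewrite ltr0n.
have r0 : 0 < r.
  by apply: lt_le_trans r_ge; rewrite mulr_gt0// exprn_gt0// divr_gt0.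
have PhiB : 0 <= Phi f (lsubmx z0) - Phi_min f by rewrite subr_ge0.
have Phif : 0 <= Phi f (lsubmx z0) - f z0.
  by rewrite subr_ge0 -{1}(hsubmxK z0); exact: le_Phi.
have VE : V = 4 * (Phi f (lsubmx z0) - Phi_min f) + (Phi f (lsubmx z0) - f z0).
  by [].
have V0 : 0 <= V by rewrite VE; lra.
set T := (L ^+ 2 * B * V ^+ 2 / _) `^ _; set S := Num.sqrt _.
have T0 : 0 <= T by exact: powR_ge0.
have S0 : 0 <= S by exact: sqrtr_ge0.
pose P (z : 'rV[R]_(dx + dy)) := sqn (grad (Phi f) (lsubmx z)).
rewrite (eq_bigr (fun k : 'I_K => mean (fun s : K.-tuple 'S_n =>
    P (sgda_epochs F v alpha beta z0 (take k s))))); last first.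
  by move=> k _; apply: eq_mean => s; rewrite enormE.
have RHS0 : 0 <= r * L * V / K%:R * S + r * T.
  by rewrite addr_ge0 ?mulr_ge0 ?invr_ge0// ltW.
(* V = 0 makes z0 a minimizer of Phi; it is only when B != 0 that the step
   size vanishes and the telescoped bound says nothing *)
case: (boolP ((V == 0) && (B != 0))) => [/andP[/eqP v0 B1]|VB].
  have beta0 : beta = 0 by exact: beta_step_eq0.
  rewrite [leLHS](_ : _ = 0) ?mulr_ge0//.
  rewrite big1 ?mulr0// => k _.
  rewrite -(mean_cst [tuple of nseq K (1%g : 'S_n)] (0 : R)); apply: eq_mean => s.
  rewrite /alpha beta0 mul0r sgda_epochs0; apply/eqP; rewrite eq_le sqn_ge0 andbT.
  have Phi0 : Phi f (lsubmx z0) - Phi_min f = 0 by lra.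
  have := sqn_grad_Phi L0 mu0 (differentiable_favg dF)
    (lipschitz_grad_favg n0 dF LF) amax PL (lsubmx z0) Phi_m.
  by rewrite Phi0 mulr0.
have beta_gt0 : 0 < beta.
  apply: beta_step_gt0 => //; move: VB; rewrite negb_and negbK.
  by case/orP => [|/eqP]; [left|right].
have small : 36 * (L ^+ 2 * beta ^+ 2 * (n%:R * (n%:R + A))) <= 1.
  exact: beta_step_small.
have tele := telescope v n0 L0 dF LF A0 B0 var1 var2 amax Phi_m mu0 muL PL r_ge
  (ltW beta_gt0) small K z0.
rewrite -/alpha -/f in tele.
set Sum := \sum_(k < K) _ in tele *.
have lyapV : lyapunov F (Phi_min f) z0 <= V by rewrite /lyapunov -/f VE; lra.
have opt : V / (K%:R * n%:R * beta) <= 6 * (L * V / K%:R * S) + T.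
  exact: beta_step_opt.
have noise : L ^+ 2 * n%:R * beta ^+ 2 * B <= T by exact: beta_step_noise.
set b2 := L ^+ 2 * _ * _ * B in tele noise.
have na0 : 0 < n%:R * alpha by rewrite mulr_gt0// divr_gt0.
have : K%:R^-1 * Sum <= V / (K%:R * (n%:R * alpha)) + 7 * (r * b2).
  rewrite -(ler_pM2l (mulr_gt0 k0 na0)).
  have -> : K%:R * (n%:R * alpha) * (K%:R^-1 * Sum) = n%:R * alpha * Sum.
    by field; rewrite gt_eqF.
  have -> : K%:R * (n%:R * alpha) * (V / (K%:R * (n%:R * alpha)) + 7 * (r * b2)) =
    V + K%:R * (n%:R * alpha * (7 * (r * b2))).
    by field; rewrite !gt_eqF// /alpha divr_gt0.
  lra.
have -> : V / (K%:R * (n%:R * alpha)) = r * (V / (K%:R * n%:R * beta)).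
  by rewrite /alpha; field; rewrite !gt_eqF.
have := ler_wpM2l (ltW r0) opt; have := ler_wpM2l (ltW r0) noise.
have h1 : 0 <= r * (L * V / K%:R * S) by rewrite !mulr_ge0 ?invr_ge0// ltW.
have -> : r * L * V / K%:R * S = r * (L * V / K%:R * S) by ring.
lra.
Qed.
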